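(* Let $a,k,\gamma,h_0,u_\infty>0$ and $\lambda\ge 0$ be constants. Let $\beta$ and $\delta$ be arbitrary real constants satisfying $\beta\ge\max(\delta,-1-\delta)$. Taking $\alpha=\beta-\delta$, there exists a unique solution $(u,s)$ of similarity type to the free boundary problem $(P)$: $$\frac{\partial u}{\partial t}(x,t)=a^2\frac{\partial^2u}{\partial x^2}(x,t)\quad(0<x<s(t),\ t>0),\qquad u(s(t),t)=0\quad (t>0),$$ $$-k\frac{\partial u}{\partial x}(s(t),t)=\gamma\, s^{\beta}(t)\,\dot s^{\delta}(t)\,\dot s(t)\quad (t>0),\qquad s(0)=0,$$ $$k\frac{\partial u}{\partial x}(0,t)=\frac{h_0}{\sqrt t}\left[\lambda u(0,t)-u_\infty t^{\alpha/2}\right]\quad (t>0).$$ It is given by $$u(x,t)=t^{\alpha/2}\left[C_1M\left(-\tfrac{\alpha}{2},\tfrac12,-\eta^2\right)+C_2\,\eta\, M\left(-\tfrac{\alpha}{2}+\tfrac12,\tfrac32,-\eta^2\right)\right],\quad \eta=\frac{x}{2a\sqrt t},\qquad s(t)=2\xi a\sqrt t,$$ where $$C_1=\frac{u_\infty\,\xi M(-\frac{\alpha}{2}+\frac12,\frac32,-\xi^2)}{\frac{k}{2ah_0}M(-\frac{\alpha}{2},\frac12,-\xi^2)+\lambda\xi M(-\frac{\alpha}{2}+\frac12,\frac32,-\xi^2)},\qquad C_2=\frac{-u_\infty M(-\frac{\alpha}{2},\frac12,-\xi^2)}{\frac{k}{2ah_0}M(-\frac{\alpha}{2},\frac12,-\xi^2)+\lambda\xi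 M(-\frac{\alpha}{2}+\frac12,\frac32,-\xi^2)},$$ and the dimensionless coefficient $\xi$ is defined as the unique positive solution of the equation $$\frac{ku_\infty}{\gamma 2^{\beta+1}a^{\beta+\delta+2}}\,f_\lambda(z)=z^{\beta+\delta+1},\quad z>0,\qquad f_\lambda(z)=\frac{1}{\frac{k}{2ah_0}M(\frac{\alpha}{2}+\frac12,\frac12,z^2)+\lambda zM(\frac{\alpha}{2}+1,\frac32,z^2)}.$$
   Context: $M$ is Kummer's confluent hypergeometric function of the first kind, $M(p,q,z)=\sum_{n=0}^{\infty}\frac{(p)_n}{(q)_n}\frac{z^n}{n!}$, with $(p)_0=1$, $(p)_n=p(p+1)\cdots(p+n-1)$ ($q$ not a non-positive integer). The dot denotes $d/dt$. The unknowns of the problem are the function $u=u(x,t)$ and the moving boundary $x=s(t)$. A solution $(u,s)$ is of similarity type if $u(x,t)=t^{\alpha/2}\varphi(\eta)$ with $\eta=\frac{x}{2a\sqrt t}$ for some function $\varphi$ of one variable, and $s(t)=2\xi a\sqrt t$ for a constant $\xi>0$.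
   Formalization: In the borderline case β = −1−δ the formal theorem also assumes γ2^β < u_∞h_0; without it the equation for ξ has no positive solution (e.g. β=δ=−1/2, γ=2, a=k=h_0=u_∞=1, λ=0), so the statement as printed fails there. *)

(* Defs.v *)
From Stdlib Require Export Reals Factorial Lra Lia.
From Coquelicot Require Export Coquelicot.

Open Scope R_scope.

Fixpoint pochhammer (p : R) (n : nat) : R :=
  match n with
  | O => 1
  | S m => pochhammer p m * (p + INR m)
  end.

Definition kummerM (p q z : R) : R :=
  PSeries (fun n => pochhammer p n / pochhammer q n / INR (fact n)) z.

Definition is_left_derive (f : R -> R) (x l : R) : Prop :=
  filterlim (fun y => (f y - f x) / (y - x)) (at_left x) (locally l).

Definition is_right_derive (f : R -> R) (x l : R) : Prop :=
  filterlim (fun y => (f y - f x) / (y - x)) (at_right x) (locally l).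

(* A function [u x t] is only meaningful for [0 < t] and [0 <= x <= s t], and
   [s] only on [0, +oo).  Both are total here; no clause below depends on their
   values elsewhere.  In particular [u]_x on the two lateral boundaries is a
   one-sided derivative.  [Rpower x y] is the real power only for [0 < x],
   hence the positivity of [s] and of its derivative. *)
Record solves_P (a k gamma h0 lambda uinf beta delta alpha : R)
    (u : R -> R -> R) (s : R -> R) : Prop := {
  P_front_pos : forall t, 0 < t -> 0 < s t;
  P_front_derive : forall t, 0 < t -> ex_derive s t /\ 0 < Derive s t;
  P_regular : forall x t, 0 < t -> 0 < x < s t ->
    ex_derive (fun t' => u x t') t /\
    ex_derive (fun x' => u x' t) x /\
    ex_derive_n (fun x' => u x' t) 2 x;
  P_heat : forall x t, 0 < t -> 0 < x < s t ->
    Derive (fun t' => u x t') t = a ^ 2 * Derive_n (fun x' => u x' t) 2 x;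
  P_front_value : forall t, 0 < t -> u (s t) t = 0;
  P_stefan : forall t, 0 < t ->
    exists ux, is_left_derive (fun x' => u x' t) (s t) ux /\
      - k * ux =
        gamma * Rpower (s t) beta * Rpower (Derive s t) delta * Derive s t;
  P_front_init : s 0 = 0;
  P_convective : forall t, 0 < t ->
    exists ux, is_right_derive (fun x' => u x' t) 0 ux /\
      k * ux = h0 / sqrt t * (lambda * u 0 t - uinf * Rpower t (alpha / 2))
}.

Definition similarity_type (a alpha : R) (u : R -> R -> R) (s : R -> R) : Prop :=
  exists (phi : R -> R) (xi : R), 0 < xi /\
    (forall t, 0 < t -> s t = 2 * xi * a * sqrt t) /\
    (forall x t, 0 < t -> 0 <= x <= s t ->
       u x t = Rpower t (alpha / 2) * phi (x / (2 * a * sqrt t))).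

Definition coefC1 (a k h0 lambda uinf alpha xi : R) : R :=
  uinf * xi * kummerM (- (alpha / 2) + 1 / 2) (3 / 2) (- xi ^ 2) /
  (k / (2 * a * h0) * kummerM (- (alpha / 2)) (1 / 2) (- xi ^ 2) +
   lambda * xi * kummerM (- (alpha / 2) + 1 / 2) (3 / 2) (- xi ^ 2)).

Definition coefC2 (a k h0 lambda uinf alpha xi : R) : R :=
  - uinf * kummerM (- (alpha / 2)) (1 / 2) (- xi ^ 2) /
  (k / (2 * a * h0) * kummerM (- (alpha / 2)) (1 / 2) (- xi ^ 2) +
   lambda * xi * kummerM (- (alpha / 2) + 1 / 2) (3 / 2) (- xi ^ 2)).

Definition u_sol (a k h0 lambda uinf alpha xi x t : R) : R :=
  let eta := x / (2 * a * sqrt t) in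
  Rpower t (alpha / 2) *
  (coefC1 a k h0 lambda uinf alpha xi *
     kummerM (- (alpha / 2)) (1 / 2) (- eta ^ 2) +
   coefC2 a k h0 lambda uinf alpha xi * eta *
     kummerM (- (alpha / 2) + 1 / 2) (3 / 2) (- eta ^ 2)).

Definition s_sol (a xi t : R) : R := 2 * xi * a * sqrt t.

Definition f_lambda (a k h0 lambda alpha z : R) : R :=
  1 / (k / (2 * a * h0) * kummerM (alpha / 2 + 1 / 2) (1 / 2) (z ^ 2) +
       lambda * z * kummerM (alpha / 2 + 1) (3 / 2) (z ^ 2)).

Definition xi_equation (a k gamma h0 lambda uinf beta delta alpha z : R) : Prop :=
  k * uinf / (gamma * Rpower 2 (beta + 1) * Rpower a (beta + delta + 2)) *
    f_lambda a k h0 lambda alpha z = Rpower z (beta + delta + 1).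

(* Main.v *)
Require Import Defs.
From Stdlib Require Import Ranalysis5.

(* A similarity profile phi satisfies phi'' + 2 x phi' - 2 alpha phi = 0, whose
   solutions are spanned by M(-alpha/2, 1/2, -x^2) and
   x M(-alpha/2 + 1/2, 3/2, -x^2): the Wronskian of two solutions is a multiple of
   exp(-x^2), and here equals it.  The front value and the convective condition
   determine the two coefficients as functions of xi, and by the Wronskian identity
   and Kummer's transformation the slope of the profile at the front is
   - uinf f_lambda(xi), so the Stefan condition is the equation for xi.  That
   equation has exactly one root because 1 / f_lambda is increasing and unbounded,
   and z^(beta + delta + 1) is nondecreasing. *)

(** * Kummer's series *)

Definition kummer_coef (p q : R) (n : nat) : R :=
  pochhammer p n / pochhammer q n / INR (fact n).

Lemma pochhammer_pos (p : R) (n : nat) : 0 < p -> 0 < pochhammer p n.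
Proof.
intros hp; induction n as [|n IH]; simpl; [lra|].
apply Rmult_lt_0_compat; [exact IH|]. pose proof (pos_INR n); lra.
Qed.

Lemma kummer_coef_pos (p q : R) (n : nat) : 0 < p -> 0 < q -> 0 < kummer_coef p q n.
Proof.
intros hp hq; unfold kummer_coef.
apply Rdiv_lt_0_compat; [apply Rdiv_lt_0_compat; now apply pochhammer_pos|].
apply INR_fact_lt_0.
Qed.

(** Ratio of consecutive coefficients, free of division; Kummer's equation reduces to it coefficient
    by coefficient. *)
Lemma kummer_coef_rec (p q : R) (n : nat) : 0 < q ->
  INR (S n) * (q + INR n) * kummer_coef p q (S n) = (p + INR n) * kummer_coef p q n.
Proof.
intros hq; unfold kummer_coef; rewrite fact_simpl, mult_INR; simpl pochhammer.
pose proof (pochhammer_pos q n hq); pose proof (pos_INR n).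
pose proof (INR_fact_neq_0 n); pose proof (lt_0_INR (S n) ltac:(lia)).
field; repeat split; lra.
Qed.

(** The radius bounds every [r] with bounded terms, so a finite radius [r] is refuted at
    [Rabs r + 1], and minus infinity at [0]. *)
Lemma CV_radius_infinite_bounded (a : nat -> R) :
  (forall r, 0 <= r -> exists B, forall n, Rabs (a n * r ^ n) <= B) ->
  CV_radius a = p_infty.
Proof.
intros h; destruct (CV_radius_bounded a) as [hub _].
assert (hle : forall r : R, 0 <= r -> Rbar_le r (CV_radius a)) by (intros r hr; now apply hub, h).
destruct (CV_radius a) as [r| |]; [|reflexivity|].
- exfalso; specialize (hle (Rabs r + 1) ltac:(pose proof (Rabs_pos r); lra)); simpl in hle.
  pose proof (Rle_abs r); lra.
- exfalso; exact (hle 0 (Rle_refl 0)).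
Qed.

(** Factor by factor, [Rabs (p + n) <= Rabs p + n <= (1 + Rabs p / q) * (q + n)]. *)
Lemma kummer_coef_bound (p q : R) (n : nat) : 0 < q ->
  Rabs (kummer_coef p q n) <= (1 + Rabs p / q) ^ n * / INR (fact n).
Proof.
intros hq; unfold kummer_coef.
assert (hpoch : Rabs (pochhammer p n) <= (1 + Rabs p / q) ^ n * pochhammer q n).
{ induction n as [|n IH]; simpl; [rewrite Rabs_R1; lra|].
  rewrite Rabs_mult.
  replace ((1 + Rabs p / q) * (1 + Rabs p / q) ^ n * (pochhammer q n * (q + INR n)))
    with ((1 + Rabs p / q) ^ n * pochhammer q n * ((1 + Rabs p / q) * (q + INR n))) by ring.
  apply Rmult_le_compat; try apply Rabs_pos; [exact IH|].
  pose proof (pos_INR n); pose proof (Rabs_pos p).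
  apply Rle_trans with (Rabs p + INR n).
  - eapply Rle_trans; [apply Rabs_triang|]; rewrite (Rabs_pos_eq (INR n)); lra.
  - replace ((1 + Rabs p / q) * (q + INR n))
      with (q + INR n + Rabs p + Rabs p * INR n / q) by (field; lra).
    assert (0 <= Rabs p * INR n / q)
      by (apply Rdiv_le_0_compat; [now apply Rmult_le_pos|lra]).
    lra. }
pose proof (pochhammer_pos q n hq) as hqn; pose proof (INR_fact_lt_0 n).
unfold Rdiv; rewrite !Rabs_mult, !Rabs_inv, (Rabs_pos_eq (INR _)), (Rabs_pos_eq (pochhammer q n)) by lra.
apply Rmult_le_compat_r; [left; now apply Rinv_0_lt_compat|].
now apply Rle_div_l.
Qed.

Lemma CV_radius_kummer (p q : R) : 0 < q -> CV_radius (kummer_coef p q) = p_infty.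
Proof.
intros hq; apply CV_radius_infinite_bounded; intros r hr.
set (c := 1 + Rabs p / q).
(* The majorants are the terms of the series of [exp (c * r)]; they tend to [0], hence are
   bounded. *)
destruct (filterlim_bounded (fun n => (c * r) ^ n * / INR (fact n))) as [B hB].
{ exists 0; apply (ex_series_lim_0 (fun n => (c * r) ^ n * / INR (fact n))).
  exists (exp (c * r)); apply is_series_ext with (2 := is_exp_Reals (c * r)); intros n.
  rewrite pow_n_pow; reflexivity. }
exists B; intros n; eapply Rle_trans; [|apply hB]; unfold norm; simpl; unfold abs; simpl.
rewrite Rabs_mult, (Rabs_pos_eq (r ^ n)) by now apply pow_le.
eapply Rle_trans; [|apply Rle_abs].
rewrite Rpow_mult_distr.
replace (c ^ n * r ^ n * / INR (fact n)) with (c ^ n * / INR (fact n) * r ^ n) by ring.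
apply Rmult_le_compat_r; [now apply pow_le|].
now apply kummer_coef_bound.
Qed.

(** Derivatives of [kummerM] in [z], taken as termwise derived series so that coefficients can be
    compared. *)
Definition kummerM1 (p q z : R) : R := PSeries (PS_derive (kummer_coef p q)) z.
Definition kummerM2 (p q z : R) : R := PSeries (PS_derive (PS_derive (kummer_coef p q))) z.

Lemma is_derive_kummerM (p q z : R) : 0 < q -> is_derive (kummerM p q) z (kummerM1 p q z).
Proof.
intros hq; apply (is_derive_PSeries (kummer_coef p q)).
now rewrite CV_radius_kummer.
Qed.

Lemma is_derive_kummerM1 (p q z : R) : 0 < q -> is_derive (kummerM1 p q) z (kummerM2 p q z).
Proof.
intros hq; apply (is_derive_PSeries (PS_derive (kummer_coef p q))).
now rewrite CV_radius_derive, CV_radius_kummer.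
Qed.

Lemma kummerM_0 (p q : R) : kummerM p q 0 = 1.
Proof. unfold kummerM; rewrite PSeries_0; simpl; field. Qed.

(** Kummer's equation, arranged without subtraction so that each side is a sum of power series. *)
Lemma kummer_ode (p q z : R) : 0 < q ->
  z * kummerM2 p q z + q * kummerM1 p q z = z * kummerM1 p q z + p * kummerM p q z.
Proof.
intros hq; unfold kummerM; fold (kummer_coef p q); unfold kummerM1, kummerM2.
assert (hcv : CV_radius (kummer_coef p q) = p_infty) by now apply CV_radius_kummer.
assert (hcv1 : CV_radius (PS_derive (kummer_coef p q)) = p_infty) by now rewrite CV_radius_derive.
assert (hcv2 : CV_radius (PS_derive (PS_derive (kummer_coef p q))) = p_infty)
  by now rewrite CV_radius_derive.
assert (hex : forall b, CV_radius b = p_infty -> ex_pseries b z)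
  by (intros b hb; apply CV_radius_inside; now rewrite hb).
assert (hscal : forall (c : R) (b : nat -> R), ex_pseries b z -> ex_pseries (PS_scal c b) z)
  by (intros c b; apply ex_pseries_scal; apply Rmult_comm).
(* Multiplication by [z] becomes an index shift. The shifted series has coefficient [0] at index
   [0], hence the case split on [n] below. *)
rewrite <- !(PSeries_incr_1 _ z), <- !PSeries_scal, <- !PSeries_plus;
  auto using ex_pseries_incr_1.
apply PSeries_ext; intros n; unfold PS_plus, PS_scal, PS_incr_1, PS_derive.
pose proof (kummer_coef_rec p q n hq) as h.
destruct n as [|n].
- simpl in h |- *; unfold plus, scal, zero; simpl; unfold mult; simpl; lra.
- rewrite !S_INR in h |- *; unfold plus, scal; cbn -[INR kummer_coef].
  unfold mult; cbn -[INR kummer_coef]; rewrite ?S_INR in *.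
  lra.
Qed.

(** * Growth of Kummer's function for positive parameters *)

Lemma PSeries_le_nonneg (a : nat -> R) (x y : R) :
  (forall n, 0 <= a n) -> 0 <= x <= y -> CV_radius a = p_infty ->
  PSeries a x <= PSeries a y.
Proof.
intros ha hxy hcv; unfold PSeries; apply Series_le.
- intros n; split.
  + apply Rmult_le_pos; [apply ha|apply pow_le; lra].
  + apply Rmult_le_compat_l; [apply ha|now apply pow_incr].
- apply ex_pseries_R, CV_radius_inside; now rewrite hcv.
Qed.

(** The tail [(M - 1) / z] has positive coefficients and value [p / q] at [0]. Being nondecreasing
    and bounded below by [p / q], it yields both the linear lower bound and the strict monotonicity
    of [kummerM]. *)
Lemma PS_decr_kummer (p q x y : R) : 0 < p -> 0 < q -> 0 <= x <= y ->
  p / q <= PSeries (PS_decr_1 (kummer_coef p q)) x <=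
  PSeries (PS_decr_1 (kummer_coef p q)) y.
Proof.
intros hp hq hxy.
assert (hpos : forall n, 0 <= PS_decr_1 (kummer_coef p q) n)
  by (intros n; left; now apply kummer_coef_pos).
assert (hcv : CV_radius (PS_decr_1 (kummer_coef p q)) = p_infty)
  by (now rewrite CV_radius_decr_1, CV_radius_kummer).
split; [|now apply PSeries_le_nonneg].
replace (p / q) with (PSeries (PS_decr_1 (kummer_coef p q)) 0).
- apply PSeries_le_nonneg; [assumption|lra|assumption].
- rewrite PSeries_0; unfold PS_decr_1, kummer_coef; simpl; field; lra.
Qed.

Lemma kummerM_decr (p q z : R) : 0 < q ->
  kummerM p q z = 1 + z * PSeries (PS_decr_1 (kummer_coef p q)) z.
Proof.
intros hq; unfold kummerM; fold (kummer_coef p q).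
rewrite PSeries_decr_1.
- f_equal; unfold kummer_coef; simpl; field.
- apply CV_radius_inside; now rewrite CV_radius_kummer.
Qed.

Lemma kummerM_lower (p q z : R) : 0 < p -> 0 < q -> 0 <= z -> 1 + p / q * z <= kummerM p q z.
Proof.
intros hp hq hz; rewrite kummerM_decr by assumption.
destruct (PS_decr_kummer p q z z hp hq ltac:(lra)); nra.
Qed.

Lemma kummerM_increasing (p q x y : R) : 0 < p -> 0 < q -> 0 <= x < y ->
  kummerM p q x < kummerM p q y.
Proof.
intros hp hq hxy; rewrite !kummerM_decr by assumption.
destruct (PS_decr_kummer p q x y hp hq ltac:(lra)).
pose proof (Rdiv_lt_0_compat p q hp hq); nra.
Qed.

Lemma kummerM_ge_1 (p q z : R) : 0 < p -> 0 < q -> 0 <= z -> 1 <= kummerM p q z.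
Proof.
intros hp hq hz; pose proof (kummerM_lower p q z hp hq hz).
pose proof (Rdiv_lt_0_compat p q hp hq); nra.
Qed.

(** * The similarity equation *)

(* Substituting [u = t^(alpha/2) f(x / (2 a sqrt t))] in the heat equation gives
   [f'' + 2 x f' - 2 alpha f = 0]; [f1] stands for [f']. *)
Definition similarity_ode (alpha l r : R) (f f1 : R -> R) : Prop :=
  forall x, l < x < r ->
    is_derive f x (f1 x) /\ is_derive f1 x (2 * alpha * f x - 2 * x * f1 x).

(** Abel's identity: the Wronskian satisfies [W' = - 2 x W], so [exp (x ^ 2) * W] has zero
    derivative. *)
Lemma similarity_ode_wronskian (alpha l r : R) (f f1 g g1 : R -> R) :
  similarity_ode alpha l r f f1 -> similarity_ode alpha l r g g1 ->
  forall x y, l < x < r -> l < y < r ->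
    exp (x ^ 2) * (f x * g1 x - f1 x * g x) = exp (y ^ 2) * (f y * g1 y - f1 y * g y).
Proof.
intros hf hg.
set (w x := exp (x ^ 2) * (f x * g1 x - f1 x * g x)).
assert (hw : forall x, l < x < r -> is_derive w x 0).
{ intros x hx; destruct (hf x hx) as [hf0 hf1]; destruct (hg x hx) as [hg0 hg1].
  unfold w; auto_derive.
  - repeat split; eexists; eassumption.
  - apply is_derive_unique in hf0, hf1, hg0, hg1.
    change (Derive (fun x => f x) x) with (Derive f x).
    change (Derive (fun x => f1 x) x) with (Derive f1 x).
    change (Derive (fun x => g x) x) with (Derive g x).
    change (Derive (fun x => g1 x) x) with (Derive g1 x).
    rewrite hf0, hf1, hg0, hg1; simpl; ring. }
assert (hlt : forall x y, l < x < r -> l < y < r -> x < y -> w x = w y).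
{ intros x y hx hy hxy; apply eq_is_derive; [|assumption].
  intros z hz; apply hw; lra. }
intros x y hx hy; change (w x = w y).
destruct (Rtotal_order x y) as [h|[->|h]]; [now apply hlt|reflexivity|symmetry; now apply hlt].
Qed.

(** Basis of solutions with initial data [(1, 0)] and [(0, 1)] at [0]. The suffix [1] marks the
    derivative in [x], obtained by the chain rule. *)
Definition even_sol (alpha x : R) : R := kummerM (- (alpha / 2)) (1 / 2) (- x ^ 2).
Definition even_sol1 (alpha x : R) : R := - 2 * x * kummerM1 (- (alpha / 2)) (1 / 2) (- x ^ 2).
Definition odd_sol (alpha x : R) : R := x * kummerM (- (alpha / 2) + 1 / 2) (3 / 2) (- x ^ 2).
Definition odd_sol1 (alpha x : R) : R :=
  kummerM (- (alpha / 2) + 1 / 2) (3 / 2) (- x ^ 2) -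
  2 * x ^ 2 * kummerM1 (- (alpha / 2) + 1 / 2) (3 / 2) (- x ^ 2).

(** The similarity equation for [even_sol] is [-4] times Kummer's equation at [z = - x ^ 2]. *)
Lemma even_sol_ode (alpha l r : R) :
  similarity_ode alpha l r (even_sol alpha) (even_sol1 alpha).
Proof.
intros x _; unfold even_sol, even_sol1.
set (p := - (alpha / 2)).
pose proof (is_derive_kummerM p (1 / 2) (- x ^ 2) ltac:(lra)) as h0.
pose proof (is_derive_kummerM1 p (1 / 2) (- x ^ 2) ltac:(lra)) as h1.
pose proof (kummer_ode p (1 / 2) (- x ^ 2) ltac:(lra)) as h2.
(* As variables, the Kummer functions are differentiated by [auto_derive] through the hypotheses
   [h0] and [h1] alone. *)
revert h0 h1 h2; generalize (kummerM p (1/2)) (kummerM1 p (1/2)) (kummerM2 p (1/2)).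
intros M M1 M2 h0 h1 h2.
split; auto_derive; try (repeat split; eexists; eassumption);
  change (x * (x * 1)) with (x ^ 2);
  change (fun y : R => M y) with M; change (fun y : R => M1 y) with M1;
  rewrite ?(is_derive_unique _ _ _ h0), ?(is_derive_unique _ _ _ h1);
  unfold p in *; lra.
Qed.

Lemma odd_sol_ode (alpha l r : R) :
  similarity_ode alpha l r (odd_sol alpha) (odd_sol1 alpha).
Proof.
intros x _; unfold odd_sol, odd_sol1.
set (p := - (alpha / 2) + 1 / 2).
pose proof (is_derive_kummerM p (3 / 2) (- x ^ 2) ltac:(lra)) as h0.
pose proof (is_derive_kummerM1 p (3 / 2) (- x ^ 2) ltac:(lra)) as h1.
pose proof (kummer_ode p (3 / 2) (- x ^ 2) ltac:(lra)) as h2.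
revert h0 h1 h2; generalize (kummerM p (3/2)) (kummerM1 p (3/2)) (kummerM2 p (3/2)).
intros M M1 M2 h0 h1 h2.
(* The multiple of Kummer's equation that gives the similarity equation; its factor depends on [x],
   so [lra] cannot find it. *)
apply (f_equal (Rmult (-4 * x))) in h2.
split; auto_derive; try (repeat split; eexists; eassumption);
  change (x * (x * 1)) with (x ^ 2);
  change (fun y : R => M y) with M; change (fun y : R => M1 y) with M1;
  rewrite ?(is_derive_unique _ _ _ h0), ?(is_derive_unique _ _ _ h1);
  unfold p in *; lra.
Qed.

(** Kummer partners of [even_sol] and [odd_sol]: [p] becomes [q - p] and the argument changes sign.
    For [alpha >= 0] all coefficients of the series are positive. *)
Definition even_exp (alpha x : R) : R := kummerM (alpha / 2 + 1 / 2) (1 / 2) (x ^ 2).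
Definition odd_exp (alpha x : R) : R := x * kummerM (alpha / 2 + 1) (3 / 2) (x ^ 2).

(** The derivative stays existential: its value at [0] is what the comparison of initial data
    requires. *)
Lemma even_exp_ode (alpha l r : R) :
  exists f1, f1 0 = 0 /\
    similarity_ode alpha l r (fun x => exp (- x ^ 2) * even_exp alpha x) f1.
Proof.
unfold even_exp; set (p := alpha / 2 + 1 / 2).
exists (fun x => exp (- x ^ 2) * (2 * x * kummerM1 p (1 / 2) (x ^ 2) - 2 * x * kummerM p (1 / 2) (x ^ 2))).
split; [ring|]; intros x _.
pose proof (is_derive_kummerM p (1 / 2) (x ^ 2) ltac:(lra)) as h0.
pose proof (is_derive_kummerM1 p (1 / 2) (x ^ 2) ltac:(lra)) as h1.
pose proof (kummer_ode p (1 / 2) (x ^ 2) ltac:(lra)) as h2.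
revert h0 h1 h2; generalize (kummerM p (1/2)) (kummerM1 p (1/2)) (kummerM2 p (1/2)).
intros M M1 M2 h0 h1 h2.
apply (f_equal (Rmult (4 * exp (- x ^ 2)))) in h2.
split; auto_derive; try (repeat split; eexists; eassumption);
  change (x * (x * 1)) with (x ^ 2);
  change (fun y : R => M y) with M; change (fun y : R => M1 y) with M1;
  rewrite ?(is_derive_unique _ _ _ h0), ?(is_derive_unique _ _ _ h1);
  unfold p in *; lra.
Qed.

Lemma odd_exp_ode (alpha l r : R) :
  exists f1, f1 0 = 1 /\
    similarity_ode alpha l r (fun x => exp (- x ^ 2) * odd_exp alpha x) f1.
Proof.
unfold odd_exp; set (p := alpha / 2 + 1).
exists (fun x => exp (- x ^ 2) * (kummerM p (3 / 2) (x ^ 2) +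
  2 * x ^ 2 * kummerM1 p (3 / 2) (x ^ 2) - 2 * x ^ 2 * kummerM p (3 / 2) (x ^ 2))).
split.
{ replace (0 ^ 2) with 0 by ring; rewrite Ropp_0, exp_0, kummerM_0; ring. }
intros x _.
pose proof (is_derive_kummerM p (3 / 2) (x ^ 2) ltac:(lra)) as h0.
pose proof (is_derive_kummerM1 p (3 / 2) (x ^ 2) ltac:(lra)) as h1.
pose proof (kummer_ode p (3 / 2) (x ^ 2) ltac:(lra)) as h2.
revert h0 h1 h2; generalize (kummerM p (3/2)) (kummerM1 p (3/2)) (kummerM2 p (3/2)).
intros M M1 M2 h0 h1 h2.
apply (f_equal (Rmult (4 * x * exp (- x ^ 2)))) in h2.
split; auto_derive; try (repeat split; eexists; eassumption);
  change (x * (x * 1)) with (x ^ 2);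
  change (fun y : R => M y) with M; change (fun y : R => M1 y) with M1;
  rewrite ?(is_derive_unique _ _ _ h0), ?(is_derive_unique _ _ _ h1);
  unfold p in *; lra.
Qed.

Lemma even_sol_0 (alpha : R) : even_sol alpha 0 = 1 /\ even_sol1 alpha 0 = 0.
Proof.
unfold even_sol, even_sol1; replace (- 0 ^ 2) with 0 by ring.
rewrite kummerM_0; split; ring.
Qed.

Lemma odd_sol_0 (alpha : R) : odd_sol alpha 0 = 0 /\ odd_sol1 alpha 0 = 1.
Proof.
unfold odd_sol, odd_sol1; replace (- 0 ^ 2) with 0 by ring.
rewrite kummerM_0; split; ring.
Qed.

Lemma wronskian_even_odd (alpha x : R) :
  even_sol alpha x * odd_sol1 alpha x - even_sol1 alpha x * odd_sol alpha x = exp (- x ^ 2).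
Proof.
(* An open interval containing both [x] and [0], where the Wronskian equals [1]. *)
set (r := Rabs x + 1).
assert (hx : - r < x < r) by (unfold r; apply Rabs_lt_between; lra).
pose proof (similarity_ode_wronskian alpha (- r) r _ _ _ _
  (even_sol_ode alpha _ _) (odd_sol_ode alpha _ _) x 0 hx
  ltac:(unfold r; pose proof (Rabs_pos x); lra)) as h.
destruct (even_sol_0 alpha) as [e0 e1], (odd_sol_0 alpha) as [o0 o1].
rewrite e0, e1, o0, o1 in h; replace (0 ^ 2) with 0 in h by ring; rewrite exp_0 in h.
rewrite exp_Ropp; pose proof (exp_pos (x ^ 2)).
apply Rmult_eq_reg_l with (exp (x ^ 2)); [|lra].
rewrite h; field; lra.
Qed.

(** Cramer's rule: the coefficients are [exp (x ^ 2)] times Wronskians of [f] with the basis,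
    constant by Abel's identity, so they may be read at the midpoint. *)
Lemma similarity_ode_general (alpha l r : R) (f f1 : R -> R) :
  l < r -> similarity_ode alpha l r f f1 ->
  exists c1 c2, forall x, l < x < r -> f x = c1 * even_sol alpha x + c2 * odd_sol alpha x /\
    f1 x = c1 * even_sol1 alpha x + c2 * odd_sol1 alpha x.
Proof.
intros hlr hf; set (m := (l + r) / 2).
assert (hm : l < m < r) by (unfold m; lra).
exists (exp (m ^ 2) * (f m * odd_sol1 alpha m - f1 m * odd_sol alpha m)),
  (exp (m ^ 2) * (even_sol alpha m * f1 m - even_sol1 alpha m * f m)).
intros x hx.
rewrite (similarity_ode_wronskian alpha l r _ _ _ _ hf (odd_sol_ode alpha _ _) m x hm hx).
rewrite (similarity_ode_wronskian alpha l r _ _ _ _ (even_sol_ode alpha _ _) hf m x hm hx).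
pose proof (wronskian_even_odd alpha x) as hw; rewrite exp_Ropp in hw.
pose proof (exp_pos (x ^ 2)).
assert (hW : exp (x ^ 2) * (even_sol alpha x * odd_sol1 alpha x
  - even_sol1 alpha x * odd_sol alpha x) = 1) by (rewrite hw; field; lra).
split; [transitivity (1 * f x); [ring|]|transitivity (1 * f1 x); [ring|]]; rewrite <- hW; ring.
Qed.

(** [f1] carries the slope at [0]; the true derivative [g] may vary with the interval, as
    [even_exp_ode] and [odd_exp_ode] provide it. *)
Lemma similarity_ode_initial (alpha : R) (f f1 : R -> R) (x : R) :
  (forall l r, exists g, g 0 = f1 0 /\ similarity_ode alpha l r f g) ->
  f x = f 0 * even_sol alpha x + f1 0 * odd_sol alpha x.
Proof.
intros hf; set (r := Rabs x + 1).
assert (hx : - r < x < r) by (unfold r; apply Rabs_lt_between; lra).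
assert (h0 : - r < 0 < r) by lra.
destruct (hf (- r) r) as [g [hg0 hg]].
destruct (similarity_ode_general alpha (- r) r f g ltac:(lra) hg) as [c1 [c2 hc]].
destruct (even_sol_0 alpha) as [e0 e1], (odd_sol_0 alpha) as [o0 o1].
destruct (hc 0 h0) as [hc0 hc1]; rewrite e0, e1, o0, o1 in *.
rewrite <- hg0, hc0, hc1; rewrite (proj1 (hc x hx)); ring.
Qed.

(* Kummer's transformation [M(p, q, z) = e^z M(q - p, q, -z)] for [q = 1/2], and
   for [q = 3/2] in [odd_sol_exp]: both sides solve the same initial value
   problem.  It turns the alternating series into series with positive terms. *)
Lemma even_sol_exp (alpha x : R) : even_sol alpha x = exp (- x ^ 2) * even_exp alpha x.
Proof.
pose proof (similarity_ode_initial alpha (fun x => exp (- x ^ 2) * even_exp alpha x)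
  (fun _ => 0) x (even_exp_ode alpha)) as h; cbv beta in h; rewrite h.
unfold even_exp; replace (- 0 ^ 2) with 0 by ring; replace (0 ^ 2) with 0 by ring.
rewrite exp_0, kummerM_0; ring.
Qed.

Lemma odd_sol_exp (alpha x : R) : odd_sol alpha x = exp (- x ^ 2) * odd_exp alpha x.
Proof.
pose proof (similarity_ode_initial alpha (fun x => exp (- x ^ 2) * odd_exp alpha x)
  (fun _ => 1) x (odd_exp_ode alpha)) as h; cbv beta in h; rewrite h.
unfold odd_exp; ring.
Qed.

(** * The equation for the front coefficient *)

(** The product is strictly increasing on the positive axis, below [K] near [0] and above [K] far
    out. For [m = 0] its limit at [0] is [kappa], hence the last hypothesis. *)
Lemma power_equation_root (Q : R -> R) (m K kappa : R) :
  0 <= m -> 0 < kappa -> 0 < K ->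
  (forall x, continuity_pt Q x) ->
  (forall x y, 0 <= x < y -> Q x < Q y) ->
  (forall x, 0 <= x -> kappa * (1 + x ^ 2) <= Q x) ->
  Q 0 = kappa -> (m = 0 -> kappa < K) ->
  exists z, unique (fun z => 0 < z /\ Rpower z m * Q z = K) z.
Proof.
intros hm hkappa hK hcont hincr hlow hQ0 hedge.
assert (hmono : forall x y, 0 < x < y -> Rpower x m * Q x < Rpower y m * Q y).
{ intros x y hxy.
  assert (hp : Rpower x m <= Rpower y m) by (apply Rle_Rpower_l; lra).
  pose proof (hincr x y ltac:(lra)); pose proof (hlow x ltac:(lra)).
  assert (0 < Rpower x m) by apply exp_pos.
  assert (0 < Q x) by nra.
  nra. }
assert (hsmall : exists x, 0 < x < 1 /\ Rpower x m * Q x < K).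
{ destruct (Req_dec m 0) as [->|hm0].
  - specialize (hedge eq_refl).
    destruct (hcont 0 (K - kappa) ltac:(lra)) as [d [hd hdist]].
    set (x := Rmin (d / 2) (1 / 2)).
    assert (hx : 0 < x < 1 /\ x < d)
      by (unfold x, Rmin; destruct (Rle_dec _ _); lra).
    exists x; split; [tauto|].
    rewrite Rpower_O by tauto.
    specialize (hdist x); simpl in hdist; unfold R_dist, D_x, no_cond in hdist.
    rewrite hQ0, Rminus_0_r, (Rabs_pos_eq x) in hdist by lra.
    assert (h : Rabs (Q x - kappa) < K - kappa) by (apply hdist; repeat split; lra).
    apply Rabs_lt_between in h; lra.
  - assert (hQ1 : 0 < Q 1) by (pose proof (hlow 1 ltac:(lra)); nra).
    (* With [x = Rpower e (/ m)] the power is [e] and [Q x < Q 1], so the product is below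
       [e * Q 1 < K]. *)
    set (e := Rmin (1 / 2) (K / Q 1 / 2)).
    assert (hKQ : 0 < K / Q 1) by now apply Rdiv_lt_0_compat.
    assert (he : 0 < e < 1 /\ e < K / Q 1)
      by (unfold e, Rmin; destruct (Rle_dec _ _); lra).
    assert (hx : 0 < Rpower e (/ m) < 1).
    { split; [apply exp_pos|].
      rewrite <- exp_0; apply exp_increasing.
      pose proof (ln_increasing e 1 ltac:(tauto) ltac:(tauto)) as hln; rewrite ln_1 in hln; pose proof (Rinv_0_lt_compat m ltac:(lra)); nra. }
    exists (Rpower e (/ m)); split; [exact hx|].
    rewrite Rpower_mult, Rinv_l, Rpower_1 by tauto.
    pose proof (hincr (Rpower e (/ m)) 1 ltac:(lra)).
    apply Rlt_trans with (e * Q 1); [nra|].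
    apply Rlt_div_r; [exact hQ1|tauto]. }
destruct hsmall as [x [hx hxK]].
(* Chosen so that [kappa * (1 + y ^ 2) > kappa * y = kappa + K], while [Rpower y m >= 1]. *)
set (y := 1 + K / kappa).
assert (hy : 1 < y) by (unfold y; pose proof (Rdiv_lt_0_compat K kappa hK hkappa); lra).
assert (hyK : K < Rpower y m * Q y).
{ assert (1 <= Rpower y m) by (rewrite <- (Rpower_O y) by lra; apply Rle_Rpower; lra).
  pose proof (hlow y ltac:(lra)).
  assert (kappa * y = kappa + K) by (unfold y; field; lra).
  assert (K < Q y) by nra.
  nra. }
destruct (IVT_interv (fun z => Rpower z m * Q z - K) x y) as [z [hz hzK]]; try lra.
{ intros z hz; apply continuity_pt_minus; [|apply continuity_pt_const; intros ? ?; reflexivity].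
  apply continuity_pt_mult; [|apply hcont].
  apply derivable_continuous_pt; eexists; apply derivable_pt_lim_power; lra. }
exists z; split; [split; lra|].
intros z' [hz' hz'K].
destruct (Rtotal_order z z') as [h|[h|h]]; [|exact h|].
- pose proof (hmono z z' ltac:(lra)); lra.
- pose proof (hmono z' z ltac:(lra)); lra.
Qed.

Lemma even_exp_increasing (alpha x y : R) : 0 <= alpha -> 0 <= x < y ->
  even_exp alpha x < even_exp alpha y.
Proof. intros ha hxy; apply kummerM_increasing; try lra; split; [nra|]; simpl; nra. Qed.

Lemma even_exp_lower (alpha x : R) : 0 <= alpha -> 1 + x ^ 2 <= even_exp alpha x.
Proof.
intros ha; unfold even_exp; pose proof (pow2_ge_0 x).
pose proof (kummerM_lower (alpha / 2 + 1 / 2) (1 / 2) (x ^ 2) ltac:(lra) ltac:(lra) ltac:(lra)) as h.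
replace ((alpha / 2 + 1 / 2) / (1 / 2)) with (alpha + 1) in h by field; nra.
Qed.

Lemma odd_exp_increasing (alpha x y : R) : 0 <= alpha -> 0 <= x < y ->
  odd_exp alpha x < odd_exp alpha y.
Proof.
intros ha hxy; unfold odd_exp.
assert (kummerM (alpha / 2 + 1) (3 / 2) (x ^ 2) < kummerM (alpha / 2 + 1) (3 / 2) (y ^ 2))
  by (apply kummerM_increasing; try lra; split; [nra|]; simpl; nra).
pose proof (kummerM_ge_1 (alpha / 2 + 1) (3 / 2) (y ^ 2) ltac:(lra) ltac:(lra) ltac:(nra)).
nra.
Qed.

Lemma odd_exp_nonneg (alpha x : R) : 0 <= alpha -> 0 <= x -> 0 <= odd_exp alpha x.
Proof.
intros ha hx; apply Rmult_le_pos; [exact hx|].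
pose proof (kummerM_ge_1 (alpha / 2 + 1) (3 / 2) (x ^ 2) ltac:(lra) ltac:(lra) ltac:(nra)); lra.
Qed.

Lemma continuity_pt_kummerM_sqr (p q x : R) : 0 < q ->
  continuity_pt (fun z => kummerM p q (z ^ 2)) x.
Proof.
intros hq; apply (continuity_pt_comp (fun z => z ^ 2)).
- apply derivable_continuous_pt, derivable_pt_pow.
- apply derivable_continuous_pt; eexists; apply is_derive_Reals; now apply is_derive_kummerM.
Qed.

(** The reciprocal of [f_lambda] once [kappa = k / (2 * a * h0)]; it serves as [Q] in
    [power_equation_root]. *)
Definition front_denom (kappa lambda alpha z : R) : R :=
  kappa * even_exp alpha z + lambda * odd_exp alpha z.

Lemma front_denom_pos (kappa lambda alpha z : R) :
  0 < kappa -> 0 <= lambda -> 0 <= alpha -> 0 <= z -> 0 < front_denom kappa lambda alpha z.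
Proof.
intros; unfold front_denom.
pose proof (even_exp_lower alpha z ltac:(assumption)).
pose proof (odd_exp_nonneg alpha z ltac:(assumption) ltac:(assumption)).
pose proof (pow2_ge_0 z); nra.
Qed.

Lemma f_lambda_denom (a k h0 lambda alpha z : R) :
  f_lambda a k h0 lambda alpha z = / front_denom (k / (2 * a * h0)) lambda alpha z.
Proof.
unfold f_lambda, front_denom, even_exp, odd_exp, Rdiv; rewrite Rmult_1_l.
f_equal; ring.
Qed.

Lemma xi_equation_denom (a k gamma h0 lambda uinf beta delta alpha z : R) :
  0 < a -> 0 < k -> 0 < h0 -> 0 <= lambda -> 0 <= alpha -> 0 <= z ->
  xi_equation a k gamma h0 lambda uinf beta delta alpha z <->
  Rpower z (beta + delta + 1) * front_denom (k / (2 * a * h0)) lambda alpha z =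
  k * uinf / (gamma * Rpower 2 (beta + 1) * Rpower a (beta + delta + 2)).
Proof.
intros ha hk hh0 hl hal hz; unfold xi_equation; rewrite f_lambda_denom.
assert (hD : 0 < front_denom (k / (2 * a * h0)) lambda alpha z)
  by (apply front_denom_pos; try assumption; apply Rdiv_lt_0_compat; nra).
set (K := k * uinf / _); set (D := front_denom _ _ _ _) in *.
split; intros h; [rewrite <- h|rewrite <- h]; field; lra.
Qed.

Lemma xi_equation_unique_root (a k gamma h0 uinf lambda beta delta alpha : R) :
  0 < a -> 0 < k -> 0 < gamma -> 0 < h0 -> 0 < uinf -> 0 <= lambda -> 0 <= alpha ->
  0 <= beta + delta + 1 ->
  (beta = -1 - delta -> gamma * Rpower 2 beta < uinf * h0) ->
  exists xi, unique (fun z => 0 < z /\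
    xi_equation a k gamma h0 lambda uinf beta delta alpha z) xi.
Proof.
intros ha hk hg hh0 hu hl hal hm hedge.
set (kappa := k / (2 * a * h0)).
assert (hkappa : 0 < kappa) by (apply Rdiv_lt_0_compat; nra).
assert (h2 : forall y, 0 < Rpower 2 y) by (intros; apply exp_pos).
assert (hap : forall y, 0 < Rpower a y) by (intros; apply exp_pos).
destruct (power_equation_root (front_denom kappa lambda alpha) (beta + delta + 1)
  (k * uinf / (gamma * Rpower 2 (beta + 1) * Rpower a (beta + delta + 2))) kappa)
  as [xi [[hxi0 hxi] hun]]; try assumption.
- apply Rdiv_lt_0_compat; [nra|]; repeat apply Rmult_lt_0_compat; auto.
- intros x; apply continuity_pt_plus; apply continuity_pt_mult;
    try (apply continuity_pt_const; intros ? ?; reflexivity).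
  + apply continuity_pt_kummerM_sqr; lra.
  + apply continuity_pt_mult; [apply continuity_pt_id|apply continuity_pt_kummerM_sqr; lra].
- intros x y hxy; unfold front_denom.
  pose proof (even_exp_increasing alpha x y hal hxy).
  pose proof (odd_exp_increasing alpha x y hal hxy); nra.
- intros x hx; unfold front_denom.
  pose proof (even_exp_lower alpha x hal).
  pose proof (odd_exp_nonneg alpha x hal hx); nra.
- unfold front_denom, even_exp, odd_exp; replace (0 ^ 2) with 0 by ring; rewrite kummerM_0; ring.
(* At exponent [0], after removal of the common factor [k / (2 * a)], [kappa < K] reads
   [/ h0 < uinf / (gamma * Rpower 2 beta)]. *)
- intros hm0; specialize (hedge ltac:(lra)).
  replace (beta + delta + 2) with 1 by lra; rewrite Rpower_1 by assumption.
  rewrite Rpower_plus, (Rpower_1 2) by lra.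
  unfold kappa; specialize (h2 beta).
  replace (k / (2 * a * h0)) with (k / (2 * a) * / h0) by (field; lra).
  replace (k * uinf / (gamma * (Rpower 2 beta * 2) * a))
    with (k / (2 * a) * (uinf / (gamma * Rpower 2 beta))) by (field; lra).
  apply Rmult_lt_compat_l; [apply Rdiv_lt_0_compat; lra|].
  apply Rlt_div_r; [nra|].
  rewrite Rmult_comm; apply Rlt_div_l; [assumption|lra].
- exists xi; split.
  + split; [assumption|]; apply xi_equation_denom; try assumption; lra.
  + intros z [hz hzeq]; apply hun; split; [assumption|].
    apply xi_equation_denom in hzeq; try assumption; lra.
Qed.

(** * One-sided derivatives *)

(** A filter finer than the punctured neighbourhoods treats left and right derivatives at once. *)
Lemma is_derive_filterlim_quotient (F : (R -> Prop) -> Prop) (f : R -> R) (x l : R) :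
  filter_le F (locally' x) -> is_derive f x l ->
  filterlim (fun y => (f y - f x) / (y - x)) F (locally l).
Proof.
intros hF hf; apply (filterlim_filter_le_1 _ hF), filterlim_locally; intros eps.
apply is_derive_Reals in hf; destruct (hf eps (cond_pos eps)) as [d hd].
exists d; intros y hy hyx.
assert (hyd : Rabs (y - x) < d) by exact hy.
specialize (hd (y - x) ltac:(lra) hyd).
rewrite Rplus_minus in hd; exact hd.
Qed.

Lemma filterlim_quotient_continuous (F : (R -> Prop) -> Prop) {FF : Filter F}
  (f : R -> R) (x l : R) :
  filter_le F (locally' x) ->
  filterlim (fun y => (f y - f x) / (y - x)) F (locally l) -> filterlim f F (locally (f x)).
Proof.
intros hF hl.
apply filterlim_ext_loc with (fun y => (f y - f x) / (y - x) * (y - x) + f x).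
- apply hF; exists (mkposreal 1 Rlt_0_1); intros y _ hy; field; lra.
- replace (locally (f x)) with (locally (l * (x - x) + f x)) by (f_equal; ring).
  apply (filterlim_comp_2 (H := locally (f x)) (G := locally (l * (x - x)))
    (fun y => (f y - f x) / (y - x) * (y - x)) (fun _ => f x) Rplus).
  + apply (filterlim_comp_2 (G := locally l) (H := locally (x - x))
      (fun y => (f y - f x) / (y - x)) (fun y => y - x) Rmult); [exact hl| |exact (filterlim_mult (K := R_AbsRing) l (x - x))].
    intros P hP; apply hF, (filter_le_within (F := locally x)).
    revert P hP; apply (ex_derive_continuous (fun y => y - x)); auto_derive; exact I.
  + apply filterlim_const.
  + exact (filterlim_plus (V := R_NormedModule) (l * (x - x)) (f x)).
Qed.

(** Carries an agreement inside the domain to its boundary: a limit of the difference quotient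
    forces continuity along [F], which identifies the boundary values, and then the quotients have
    the same limit. *)
Lemma one_sided_derive_unique (F : (R -> Prop) -> Prop) {FF : ProperFilter F}
  (f g : R -> R) (x l l' : R) :
  filter_le F (locally' x) ->
  filterlim (fun y => (f y - f x) / (y - x)) F (locally l) ->
  F (fun y => f y = g y) -> is_derive g x l' -> f x = g x /\ l = l'.
Proof.
intros hF hf hfg hg.
assert (hx : f x = g x).
{ apply (filterlim_locally_unique f (F := F)); [apply filterlim_quotient_continuous with l; [apply FF|assumption|assumption]|].
  apply filterlim_ext_loc with g; [now apply filter_imp with (2 := hfg)|].
  apply filterlim_quotient_continuous with l'; [apply FF|assumption|].
  now apply is_derive_filterlim_quotient. }
split; [exact hx|].
apply (filterlim_locally_unique (fun y => (f y - f x) / (y - x)) (F := F)); [assumption|].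
apply filterlim_ext_loc with (fun y => (g y - g x) / (y - x)).
- apply filter_imp with (2 := hfg); intros y ->; now rewrite hx.
- now apply is_derive_filterlim_quotient.
Qed.

Lemma at_left_le_locally' (x : R) : filter_le (at_left x) (locally' x).
Proof. intros P [d hd]; exists d; intros y hy hyx; apply hd; [exact hy|lra]. Qed.

Lemma at_right_le_locally' (x : R) : filter_le (at_right x) (locally' x).
Proof. intros P [d hd]; exists d; intros y hy hyx; apply hd; [exact hy|lra]. Qed.

(** * Similarity solutions *)

Lemma is_derive_similarity_x (a c t x d : R) (phi : R -> R) :
  0 < a -> 0 < t -> is_derive phi (x / (2 * a * sqrt t)) d ->
  is_derive (fun x' => c * phi (x' / (2 * a * sqrt t))) x (c * d / (2 * a * sqrt t)).
Proof.
intros ha ht hphi; pose proof (sqrt_lt_R0 t ht).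
auto_derive.
- repeat split; try nra; try (eexists; exact hphi).
- change (fun y : R => phi y) with phi.
  change (x * / (2 * a * sqrt t)) with (x / (2 * a * sqrt t)).
  rewrite (is_derive_unique _ _ _ hphi); field; nra.
Qed.

(** The similarity variable [eta] has time derivative [- eta / (2 t)]. *)
Lemma is_derive_similarity_t (a c t x d : R) (phi : R -> R) :
  0 < a -> 0 < t -> is_derive phi (x / (2 * a * sqrt t)) d ->
  is_derive (fun t' => Rpower t' c * phi (x / (2 * a * sqrt t'))) t
    (Rpower t c / t * (c * phi (x / (2 * a * sqrt t)) - x / (2 * a * sqrt t) / 2 * d)).
Proof.
intros ha ht hphi; pose proof (sqrt_lt_R0 t ht).
unfold Rpower; auto_derive.
- repeat split; try assumption; try nra; eexists; exact hphi.
- change (fun y : R => phi y) with phi.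
  change (x * / (2 * a * sqrt t)) with (x / (2 * a * sqrt t)).
  rewrite (is_derive_unique _ _ _ hphi).
  generalize (phi (x / (2 * a * sqrt t))); intros p.
  assert (hs : sqrt t * sqrt t = t) by (apply sqrt_sqrt; lra).
  set (r := sqrt t) in *; rewrite <- hs; field; lra.
Qed.

Lemma is_derive_scaled_sqrt (c t : R) : 0 < t ->
  is_derive (fun t' => c * sqrt t') t (c / (2 * sqrt t)).
Proof.
intros ht; pose proof (sqrt_lt_R0 t ht); auto_derive; [assumption|field; lra].
Qed.

Definition ode_sol (alpha c1 c2 x : R) : R := c1 * even_sol alpha x + c2 * odd_sol alpha x.
Definition ode_sol1 (alpha c1 c2 x : R) : R := c1 * even_sol1 alpha x + c2 * odd_sol1 alpha x.

Lemma ode_sol_ode (alpha c1 c2 x : R) :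
  is_derive (ode_sol alpha c1 c2) x (ode_sol1 alpha c1 c2 x) /\
  is_derive (ode_sol1 alpha c1 c2) x
    (2 * alpha * ode_sol alpha c1 c2 x - 2 * x * ode_sol1 alpha c1 c2 x).
Proof.
destruct (even_sol_ode alpha (x - 1) (x + 1) x ltac:(lra)) as [e0 e1].
destruct (odd_sol_ode alpha (x - 1) (x + 1) x ltac:(lra)) as [o0 o1].
split; [unfold ode_sol, ode_sol1|unfold ode_sol1 at 1].
- apply (is_derive_plus (fun x => c1 * even_sol alpha x) (fun x => c2 * odd_sol alpha x));
    now apply is_derive_scal.
- replace (2 * alpha * ode_sol alpha c1 c2 x - 2 * x * ode_sol1 alpha c1 c2 x) with
    (c1 * (2 * alpha * even_sol alpha x - 2 * x * even_sol1 alpha x) +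
     c2 * (2 * alpha * odd_sol alpha x - 2 * x * odd_sol1 alpha x))
    by (unfold ode_sol, ode_sol1; ring).
  apply (is_derive_plus (fun x => c1 * even_sol1 alpha x) (fun x => c2 * odd_sol1 alpha x));
    now apply is_derive_scal.
Qed.

Lemma ode_sol_0 (alpha c1 c2 : R) :
  ode_sol alpha c1 c2 0 = c1 /\ ode_sol1 alpha c1 c2 0 = c2.
Proof.
unfold ode_sol, ode_sol1; destruct (even_sol_0 alpha) as [-> ->], (odd_sol_0 alpha) as [-> ->].
split; ring.
Qed.

(** For [kappa = k / (2 * a * h0)] the left side is the common denominator of [coefC1] and [coefC2];
    this form shows it positive. *)
Lemma boundary_denom (kappa lambda alpha xi : R) :
  kappa * even_sol alpha xi + lambda * odd_sol alpha xi =
  exp (- xi ^ 2) * front_denom kappa lambda alpha xi.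
Proof. rewrite even_sol_exp, odd_sol_exp; unfold front_denom; ring. Qed.

(** The front and convective conditions, with powers of [t] divided out, form a linear system with
    nonzero determinant. One direction serves existence, the other uniqueness. *)
Lemma boundary_coefs (a k h0 lambda uinf alpha xi c1 c2 : R) :
  0 < a -> 0 < k -> 0 < h0 -> 0 <= lambda -> 0 <= alpha -> 0 <= xi ->
  (ode_sol alpha c1 c2 xi = 0 /\ k / (2 * a * h0) * c2 = lambda * c1 - uinf) <->
  (c1 = coefC1 a k h0 lambda uinf alpha xi /\ c2 = coefC2 a k h0 lambda uinf alpha xi).
Proof.
intros ha hk hh0 hl hal hxi.
pose proof (boundary_denom (k / (2 * a * h0)) lambda alpha xi) as hD.
assert (hkappa : 0 < k / (2 * a * h0)) by (apply Rdiv_lt_0_compat; nra).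
assert (hD0 : 0 < k / (2 * a * h0) * even_sol alpha xi + lambda * odd_sol alpha xi).
{ rewrite hD; apply Rmult_lt_0_compat; [apply exp_pos|now apply front_denom_pos]. }
assert (h1 : coefC1 a k h0 lambda uinf alpha xi = uinf * odd_sol alpha xi /
  (k / (2 * a * h0) * even_sol alpha xi + lambda * odd_sol alpha xi))
  by (unfold coefC1, even_sol, odd_sol; rewrite <- !Rmult_assoc; reflexivity).
assert (h2 : coefC2 a k h0 lambda uinf alpha xi = - uinf * even_sol alpha xi /
  (k / (2 * a * h0) * even_sol alpha xi + lambda * odd_sol alpha xi))
  by (unfold coefC2, even_sol, odd_sol; rewrite <- !Rmult_assoc; reflexivity).
rewrite h1, h2; unfold ode_sol; clear hD h1 h2.
revert hkappa hD0; generalize (k / (2 * a * h0)) (even_sol alpha xi) (odd_sol alpha xi).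
intros kappa A B hkappa hD0; split; intros [e1 e2].
- split; apply Rmult_eq_reg_r with (kappa * A + lambda * B); try lra;
    unfold Rdiv; rewrite (Rmult_assoc _ (/ _)), Rinv_l, Rmult_1_r by lra.
  + transitivity (kappa * (c1 * A + c2 * B) - (kappa * c2 - lambda * c1) * B); [ring|].
    rewrite e1, e2; ring.
  + transitivity (lambda * (c1 * A + c2 * B) + (kappa * c2 - lambda * c1) * A); [ring|].
    rewrite e1, e2; ring.
- rewrite e1, e2; split; field; lra.
Qed.

(* With the coefficients fixed by the two boundary conditions, the slope at the
   front is [- uinf] times the Wronskian divided by the common denominator. *)
Lemma front_slope (a k h0 lambda uinf alpha xi : R) :
  0 < a -> 0 < k -> 0 < h0 -> 0 <= lambda -> 0 <= alpha -> 0 <= xi ->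
  ode_sol1 alpha (coefC1 a k h0 lambda uinf alpha xi) (coefC2 a k h0 lambda uinf alpha xi) xi =
  - uinf * f_lambda a k h0 lambda alpha xi.
Proof.
intros ha hk hh0 hl hal hxi.
destruct (proj2 (boundary_coefs a k h0 lambda uinf alpha xi _ _ ha hk hh0 hl hal hxi)
  (conj eq_refl eq_refl)) as [e1 e2].
set (c1 := coefC1 _ _ _ _ _ _ _) in *; set (c2 := coefC2 _ _ _ _ _ _ _) in *.
rewrite f_lambda_denom.
assert (hkappa : 0 < k / (2 * a * h0)) by (apply Rdiv_lt_0_compat; nra).
pose proof (front_denom_pos _ lambda alpha xi hkappa hl hal hxi) as hQ.
pose proof (boundary_denom (k / (2 * a * h0)) lambda alpha xi) as hD.
pose proof (wronskian_even_odd alpha xi) as hW; pose proof (exp_pos (- xi ^ 2)) as hE.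
set (Q := front_denom _ _ _ _) in *; unfold ode_sol, ode_sol1 in *.
revert hkappa e2 hD; generalize (k / (2 * a * h0)); intros kappa hkappa e2 hD.
apply Rmult_eq_reg_r with (exp (- xi ^ 2) * Q); [|nra].
transitivity (- uinf * exp (- xi ^ 2)); [|field; lra].
rewrite <- hD, <- hW.
set (A := even_sol alpha xi) in *; set (B := odd_sol alpha xi) in *.
set (A1 := even_sol1 alpha xi) in *; set (B1 := odd_sol1 alpha xi) in *.
(* In this identity [e1] annihilates the first product, and [e2] turns the factor of the Wronskian
   into [- uinf]. *)
transitivity ((c1 * A + c2 * B) * (kappa * A1 + lambda * B1) +
  (kappa * c2 - lambda * c1) * (A * B1 - A1 * B)); [ring|].
rewrite e1, e2; ring.
Qed.

(** Here [alpha = beta - delta] matters: the right side of the Stefan condition scales as [t] to the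
    power [(beta - delta - 1) / 2], and the flux as [t] to the power [(alpha - 1) / 2]. All powers
    are written as exponentials and their exponents compared. *)
Lemma stefan_condition_scaling (a gamma beta delta alpha t xi : R) :
  0 < a -> 0 < t -> 0 < xi -> alpha = beta - delta ->
  gamma * Rpower (2 * xi * a * sqrt t) beta * Rpower (2 * xi * a / (2 * sqrt t)) delta
    * (2 * xi * a / (2 * sqrt t)) =
  gamma * Rpower 2 beta * Rpower a (beta + delta + 1) * Rpower xi (beta + delta + 1) *
    (Rpower t (alpha / 2) / sqrt t).
Proof.
intros ha ht hxi halpha; pose proof (sqrt_lt_R0 t ht) as hs.
assert (hst : sqrt t = exp (ln t / 2)) by (rewrite <- Rpower_sqrt by assumption; unfold Rpower; f_equal; field).
assert (h1 : 2 * xi * a * sqrt t = exp (ln 2 + ln xi + ln a + ln t / 2))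
  by (rewrite !exp_plus, !exp_ln by lra; now rewrite hst).
assert (h2 : 2 * xi * a / (2 * sqrt t) = exp (ln xi + ln a - ln t / 2)).
{ unfold Rminus; rewrite !exp_plus, exp_Ropp, !exp_ln by lra; rewrite hst.
  field; apply Rgt_not_eq, exp_pos. }
rewrite h1, h2; unfold Rpower; rewrite !ln_exp.
replace (exp (alpha / 2 * ln t) / sqrt t) with (exp (alpha / 2 * ln t - ln t / 2))
  by (unfold Rminus; rewrite exp_plus, exp_Ropp, hst; reflexivity).
rewrite !Rmult_assoc, <- !exp_plus; do 2 f_equal.
rewrite halpha; field.
Qed.

(** The time factor cancels, so the Stefan condition at any single [t > 0] is already the equation
    for [xi]. *)
Lemma stefan_xi_equation (a k gamma h0 lambda uinf beta delta alpha t xi : R) :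
  0 < a -> 0 < gamma -> 0 < t -> 0 < xi -> alpha = beta - delta ->
  - k * (Rpower t (alpha / 2) * (- uinf * f_lambda a k h0 lambda alpha xi) / (2 * a * sqrt t)) =
    gamma * Rpower (2 * xi * a * sqrt t) beta * Rpower (2 * xi * a / (2 * sqrt t)) delta
    * (2 * xi * a / (2 * sqrt t)) <->
  xi_equation a k gamma h0 lambda uinf beta delta alpha xi.
Proof.
intros ha hg ht hxi halpha; pose proof (sqrt_lt_R0 t ht) as hs.
rewrite stefan_condition_scaling with (alpha := alpha) by assumption.
unfold xi_equation.
replace (beta + delta + 2) with (beta + delta + 1 + 1) by ring.
rewrite (Rpower_plus (beta + delta + 1) 1 a), (Rpower_plus beta 1 2), !Rpower_1 by lra.
assert (hP : forall x y, 0 < Rpower x y) by (intros; apply exp_pos).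
pose proof (hP t (alpha / 2)); pose proof (hP 2 beta); pose proof (hP a (beta + delta + 1)).
generalize dependent (Rpower t (alpha / 2)); intros T hT.
generalize dependent (Rpower 2 beta); intros P hP2.
generalize dependent (Rpower a (beta + delta + 1)); intros A hA.
generalize (Rpower xi (beta + delta + 1)) (f_lambda a k h0 lambda alpha xi); intros X f.
generalize dependent (sqrt t); intros r hr.
assert (hc : 0 < gamma * P * A * (T / r)).
{ repeat apply Rmult_lt_0_compat; try assumption; now apply Rinv_0_lt_compat. }
split; intros h.
- apply Rmult_eq_reg_l with (gamma * P * A * (T / r)); [|lra].
  transitivity (gamma * P * A * X * (T / r)); [|ring].
  rewrite <- h; field; lra.
- rewrite <- h; field; lra.
Qed.

Lemma Rpower_1_l (c : R) : Rpower 1 c = 1.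
Proof. unfold Rpower; rewrite ln_1, Rmult_0_r; apply exp_0. Qed.

Lemma u_sol_ode_sol (a k h0 lambda uinf alpha xi x t : R) :
  u_sol a k h0 lambda uinf alpha xi x t =
  Rpower t (alpha / 2) * ode_sol alpha (coefC1 a k h0 lambda uinf alpha xi)
    (coefC2 a k h0 lambda uinf alpha xi) (x / (2 * a * sqrt t)).
Proof. unfold u_sol, ode_sol, even_sol, odd_sol; cbv zeta; f_equal; ring. Qed.

Lemma Derive_s_sol (a xi t : R) : 0 < t -> Derive (s_sol a xi) t = 2 * xi * a / (2 * sqrt t).
Proof. intros ht; apply is_derive_unique, is_derive_scaled_sqrt, ht. Qed.

(** For [t > 0] the explicit [u] is differentiable in [x] on the whole line, so its one-sided
    boundary derivatives are ordinary ones. *)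
Lemma u_sol_solves (a k gamma h0 uinf lambda beta delta alpha xi : R) :
  0 < a -> 0 < k -> 0 < gamma -> 0 < h0 -> 0 <= lambda -> 0 <= alpha ->
  alpha = beta - delta -> 0 < xi ->
  xi_equation a k gamma h0 lambda uinf beta delta alpha xi ->
  solves_P a k gamma h0 lambda uinf beta delta alpha
    (u_sol a k h0 lambda uinf alpha xi) (s_sol a xi).
Proof.
intros ha hk hg hh0 hl hal halpha hxi heq.
destruct (proj2 (boundary_coefs a k h0 lambda uinf alpha xi _ _ ha hk hh0 hl hal ltac:(lra))
  (conj eq_refl eq_refl)) as [hfront hconv].
pose proof (front_slope a k h0 lambda uinf alpha xi ha hk hh0 hl hal ltac:(lra)) as hslope.
pose proof (u_sol_ode_sol a k h0 lambda uinf alpha xi) as hu.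
set (u := u_sol a k h0 lambda uinf alpha xi) in *.
set (c1 := coefC1 a k h0 lambda uinf alpha xi) in *.
set (c2 := coefC2 a k h0 lambda uinf alpha xi) in *.
assert (hut : forall x t, 0 < t -> is_derive (fun t' => u x t') t
  (Rpower t (alpha / 2) / t * (alpha / 2 * ode_sol alpha c1 c2 (x / (2 * a * sqrt t)) -
     x / (2 * a * sqrt t) / 2 * ode_sol1 alpha c1 c2 (x / (2 * a * sqrt t))))).
{ intros x t ht; eapply is_derive_ext; [intros t'; symmetry; apply hu|].
  apply is_derive_similarity_t; try assumption; apply ode_sol_ode. }
assert (hux : forall x t, 0 < t -> is_derive (fun x' => u x' t) x
  (Rpower t (alpha / 2) * ode_sol1 alpha c1 c2 (x / (2 * a * sqrt t)) / (2 * a * sqrt t))).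
{ intros x t ht; eapply is_derive_ext; [intros x'; symmetry; apply hu|].
  apply is_derive_similarity_x; try assumption; apply ode_sol_ode. }
assert (huxx : forall x t, 0 < t -> is_derive (Derive (fun x' => u x' t)) x
  (Rpower t (alpha / 2) / (2 * a * sqrt t) *
   (2 * alpha * ode_sol alpha c1 c2 (x / (2 * a * sqrt t)) -
    2 * (x / (2 * a * sqrt t)) * ode_sol1 alpha c1 c2 (x / (2 * a * sqrt t))) / (2 * a * sqrt t))).
{ intros x t ht.
  apply is_derive_ext with (fun x' => Rpower t (alpha / 2) / (2 * a * sqrt t) *
    ode_sol1 alpha c1 c2 (x' / (2 * a * sqrt t))).
  - intros x'; symmetry; apply is_derive_unique.
    replace (Rpower t (alpha / 2) / (2 * a * sqrt t) * ode_sol1 alpha c1 c2 (x' / (2 * a * sqrt t)))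
      with (Rpower t (alpha / 2) * ode_sol1 alpha c1 c2 (x' / (2 * a * sqrt t)) / (2 * a * sqrt t))
      by (unfold Rdiv; ring).
    now apply hux.
  - apply is_derive_similarity_x; try assumption; apply ode_sol_ode. }
split.
- intros t ht; unfold s_sol; pose proof (sqrt_lt_R0 t ht).
  repeat apply Rmult_lt_0_compat; lra.
- intros t ht; split; [eexists; now apply is_derive_scaled_sqrt|].
  rewrite Derive_s_sol by assumption; pose proof (sqrt_lt_R0 t ht).
  apply Rdiv_lt_0_compat; nra.
- intros x t ht _; repeat split; [eexists; now apply hut|eexists; now apply hux|].
  eexists; now apply huxx.
- intros x t ht _.
  eapply eq_trans; [apply is_derive_unique, hut, ht|].
  change (Derive_n (fun x' => u x' t) 2 x) with (Derive (Derive (fun x' => u x' t)) x).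
  rewrite (is_derive_unique _ _ _ (huxx x t ht)).
  pose proof (sqrt_lt_R0 t ht).
  (* With [t] written as the square of [sqrt t], the heat equation becomes a rational identity. *)
  assert (hs : t = sqrt t * sqrt t) by (symmetry; apply sqrt_sqrt; lra).
  generalize (Rpower t (alpha / 2)) (ode_sol alpha c1 c2 (x / (2 * a * sqrt t)))
    (ode_sol1 alpha c1 c2 (x / (2 * a * sqrt t))); intros T p p1.
  set (r := sqrt t) in *; rewrite hs; field; lra.
- intros t ht; rewrite hu; pose proof (sqrt_lt_R0 t ht).
  replace (s_sol a xi t / (2 * a * sqrt t)) with xi by (unfold s_sol; field; lra).
  rewrite hfront; ring.
- intros t ht; pose proof (sqrt_lt_R0 t ht).
  exists (Rpower t (alpha / 2) * ode_sol1 alpha c1 c2 xi / (2 * a * sqrt t)); split.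
  + apply is_derive_filterlim_quotient; [apply at_left_le_locally'|].
    pose proof (hux (s_sol a xi t) t ht) as h.
    replace (s_sol a xi t / (2 * a * sqrt t)) with xi in h by (unfold s_sol; field; lra).
    exact h.
  + rewrite Derive_s_sol by assumption; rewrite hslope; unfold s_sol.
    now apply stefan_xi_equation.
- unfold s_sol; rewrite sqrt_0; ring.
- intros t ht; pose proof (sqrt_lt_R0 t ht).
  assert (h00 : 0 / (2 * a * sqrt t) = 0) by (field; lra).
  exists (Rpower t (alpha / 2) * c2 / (2 * a * sqrt t)); split.
  + apply is_derive_filterlim_quotient; [apply at_right_le_locally'|].
    pose proof (hux 0 t ht) as h; rewrite h00 in h.
    now rewrite (proj2 (ode_sol_0 alpha c1 c2)) in h.
  + rewrite hu, h00, (proj1 (ode_sol_0 alpha c1 c2)).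
    transitivity (h0 / sqrt t * Rpower t (alpha / 2) * (k / (2 * a * h0) * c2)); [field; lra|].
    rewrite hconv; ring.
Qed.

Lemma u_sol_similarity_type (a k h0 uinf lambda alpha xi : R) :
  0 < xi -> similarity_type a alpha (u_sol a k h0 lambda uinf alpha xi) (s_sol a xi).
Proof.
intros hxi; eexists; exists xi; split; [exact hxi|split; [reflexivity|]].
intros x t ht hx; apply u_sol_ode_sol.
Qed.

(** * Uniqueness among similarity solutions *)

(** At [t = 1] the profile is [u (2 * a * x) 1], so it inherits the regularity of [u] in [x]. The
    similarity form gives the time derivative there, and the heat equation relates it to the second
    space derivative. *)
Lemma similarity_profile_ode (a k gamma h0 uinf lambda beta delta alpha xi : R)
  (u : R -> R -> R) (s phi : R -> R) :
  0 < a -> 0 < xi ->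
  solves_P a k gamma h0 lambda uinf beta delta alpha u s ->
  (forall t, 0 < t -> s t = 2 * xi * a * sqrt t) ->
  (forall x t, 0 < t -> 0 <= x <= s t ->
    u x t = Rpower t (alpha / 2) * phi (x / (2 * a * sqrt t))) ->
  similarity_ode alpha 0 xi (fun x => u (2 * a * x) 1)
    (fun x => 2 * a * Derive (fun y => u y 1) (2 * a * x)).
Proof.
intros ha hxi hP hs hu.
set (psi x := u (2 * a * x) 1); set (psi1 x := 2 * a * Derive (fun y => u y 1) (2 * a * x)).
assert (s1 : s 1 = 2 * a * xi) by (rewrite hs, sqrt_1 by lra; ring).
assert (psi_phi : forall x, 0 <= x <= xi -> psi x = phi x).
{ intros x hx; unfold psi; rewrite hu; [|lra|rewrite s1; nra].
  rewrite sqrt_1, Rpower_1_l, Rmult_1_l; f_equal; field; lra. }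
intros x hx.
assert (hx1 : 0 < 2 * a * x < s 1) by (rewrite s1; nra).
destruct (P_regular _ _ _ _ _ _ _ _ _ _ _ hP (2 * a * x) 1 Rlt_0_1 hx1) as [_ [hex1 hex2]].
assert (hpsi : is_derive psi x (psi1 x)).
{ unfold psi, psi1.
  apply (is_derive_comp (fun y => u y 1) (fun x => 2 * a * x)).
  - now apply Derive_correct.
  - auto_derive; [exact I|ring]. }
split; [exact hpsi|].
assert (ht : is_derive (fun t => u (2 * a * x) t) 1 (alpha / 2 * psi x - x / 2 * psi1 x)).
{ apply is_derive_ext_loc with (fun t => Rpower t (alpha / 2) * psi (2 * a * x / (2 * a * sqrt t))).
  (* For [t] within [d] of [1], [t > (x / xi) ^ 2]: the point [2 * a * x] is still behind the front,
     and [x / sqrt t] stays in [[0, xi]]. *)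
  - set (d := (1 - (x / xi) ^ 2)).
    assert (hq : 0 < x / xi < 1) by (split; [apply Rdiv_lt_0_compat; lra|apply Rlt_div_l; lra]).
    assert (hd : 0 < d) by (unfold d; nra).
    exists (mkposreal d hd); intros t htd.
    assert (htd' : Rabs (t - 1) < d) by exact htd.
    apply Rabs_lt_between in htd'; unfold d in htd'.
    assert (htpos : (x / xi) ^ 2 < t) by lra.
    assert (ht0 : 0 < t) by (pose proof (pow2_ge_0 (x / xi)); lra).
    pose proof (sqrt_lt_R0 t ht0) as hr.
    assert (hxr : x / xi < sqrt t).
    { rewrite <- (sqrt_pow2 (x / xi)) by lra; apply sqrt_lt_1; nra. }
    assert (hxs : x < xi * sqrt t) by (rewrite Rmult_comm; now apply Rlt_div_l).
    rewrite hu; [|assumption|rewrite hs by assumption; nra].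
    rewrite psi_phi; [reflexivity|].
    replace (2 * a * x / (2 * a * sqrt t)) with (x / sqrt t) by (field; lra).
    split; [apply Rdiv_le_0_compat; lra|].
    apply Rle_div_l; lra.
  - assert (e : 2 * a * x / (2 * a * sqrt 1) = x) by (rewrite sqrt_1; field; lra).
    pose proof (is_derive_similarity_t a (alpha / 2) 1 (2 * a * x) (psi1 x) psi ha Rlt_0_1) as h.
    rewrite !e, Rpower_1_l in h.
    replace (alpha / 2 * psi x - x / 2 * psi1 x) with
      (1 / 1 * (alpha / 2 * psi x - x / 2 * psi1 x)) by field.
    now apply h. }
pose proof (P_heat _ _ _ _ _ _ _ _ _ _ _ hP (2 * a * x) 1 Rlt_0_1 hx1) as hheat.
apply is_derive_unique in ht; apply (eq_trans (eq_sym ht)) in hheat.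
replace (2 * alpha * psi x - 2 * x * psi1 x)
  with (2 * a * (2 * a * Derive_n (fun y => u y 1) 2 (2 * a * x))) by lra.
apply is_derive_scal.
apply (is_derive_comp (Derive (fun y => u y 1)) (fun x => 2 * a * x)).
- now apply Derive_correct.
- auto_derive; [exact I|ring].
Qed.

(** All is read at [t = 1]: the equation gives two constants on the open interval, the boundary
    conditions fix them, and the Stefan condition gives the equation for [xi]. *)
Lemma similarity_profile_determined (a k gamma h0 uinf lambda beta delta alpha xi : R)
  (u : R -> R -> R) (s phi : R -> R) :
  0 < a -> 0 < k -> 0 < gamma -> 0 < h0 -> 0 <= lambda -> 0 <= alpha ->
  alpha = beta - delta -> 0 < xi ->
  solves_P a k gamma h0 lambda uinf beta delta alpha u s ->
  (forall t, 0 < t -> s t = 2 * xi * a * sqrt t) ->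
  (forall x t, 0 < t -> 0 <= x <= s t ->
    u x t = Rpower t (alpha / 2) * phi (x / (2 * a * sqrt t))) ->
  xi_equation a k gamma h0 lambda uinf beta delta alpha xi /\
  forall x, 0 <= x <= xi -> phi x = ode_sol alpha (coefC1 a k h0 lambda uinf alpha xi)
    (coefC2 a k h0 lambda uinf alpha xi) x.
Proof.
intros ha hk hgamma hh0 hlambda halpha0 halpha hxi hP hs hu.
assert (s1 : s 1 = 2 * a * xi) by (rewrite hs, sqrt_1 by lra; ring).
pose proof (similarity_profile_ode _ _ _ _ _ _ _ _ _ _ _ _ _ ha hxi hP hs hu) as psi_ode.
destruct (similarity_ode_general alpha 0 xi _ _ hxi psi_ode) as [c1 [c2 hc]].
(* The trivial factors [1] and [sqrt 1] match [is_derive_similarity_x] at [t = 1]. *)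
set (g x := 1 * ode_sol alpha c1 c2 (x / (2 * a * sqrt 1))).
assert (hg : forall x, is_derive g x (1 * ode_sol1 alpha c1 c2 (x / (2 * a * sqrt 1)) / (2 * a * sqrt 1))).
{ intros x; apply is_derive_similarity_x; [assumption|lra|apply ode_sol_ode]. }
assert (hug : forall x, 0 < x < s 1 -> u x 1 = g x).
{ intros x hx; rewrite s1 in hx; unfold g; rewrite sqrt_1, !Rmult_1_r, Rmult_1_l.
  assert (hx' : 0 < x / (2 * a) < xi)
    by (split; [apply Rdiv_lt_0_compat|apply Rlt_div_l]; lra).
  unfold ode_sol; rewrite <- (proj1 (hc _ hx')); f_equal; field; lra. }
assert (hs1 : 0 < s 1) by (rewrite s1; nra).
destruct (P_stefan _ _ _ _ _ _ _ _ _ _ _ hP 1 Rlt_0_1) as [l [hl hstefan]].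
destruct (P_convective _ _ _ _ _ _ _ _ _ _ _ hP 1 Rlt_0_1) as [m [hm hconv]].
assert (hleft : at_left (s 1) (fun x => u x 1 = g x)).
{ exists (mkposreal _ hs1); intros y hy hys; apply hug.
  assert (hy' : Rabs (y - s 1) < s 1) by exact hy.
  apply Rabs_lt_between in hy'; lra. }
assert (hright : at_right 0 (fun x => u x 1 = g x)).
{ exists (mkposreal _ hs1); intros y hy hy0; apply hug.
  assert (hy' : Rabs (y - 0) < s 1) by exact hy.
  apply Rabs_lt_between in hy'; lra. }
destruct (one_sided_derive_unique (at_left (s 1)) (fun x => u x 1) g (s 1) l _
  (at_left_le_locally' _) hl hleft (hg (s 1))) as [hus hl'].
destruct (one_sided_derive_unique (at_right 0) (fun x => u x 1) g 0 m _
  (at_right_le_locally' _) hm hright (hg 0)) as [hu0 hm'].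
assert (es : s 1 / (2 * a * sqrt 1) = xi) by (rewrite s1, sqrt_1; field; lra).
assert (e0 : 0 / (2 * a * sqrt 1) = 0) by (rewrite sqrt_1; field; lra).
unfold g in hus, hu0; rewrite es in hus, hl'; rewrite e0 in hu0, hm'.
destruct (ode_sol_0 alpha c1 c2) as [g0 g1]; rewrite g0 in hu0; rewrite g1 in hm'.
assert (hcoef : c1 = coefC1 a k h0 lambda uinf alpha xi /\
                c2 = coefC2 a k h0 lambda uinf alpha xi).
{ apply boundary_coefs; try assumption; [lra|]; split.
  - rewrite (P_front_value _ _ _ _ _ _ _ _ _ _ _ hP 1 Rlt_0_1) in hus; lra.
  - rewrite hm', hu0, Rpower_1_l, sqrt_1 in hconv.
    apply Rmult_eq_reg_l with h0; [|lra].
    transitivity (k * (1 * c2 / (2 * a * 1))); [field; lra|].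
    rewrite hconv; field. }
destruct hcoef as [hc1 hc2].
split.
- apply (stefan_xi_equation a k gamma h0 lambda uinf beta delta alpha 1 xi);
    try assumption; try lra.
  rewrite <- front_slope by (assumption || lra).
  (* The formula for [s] is known for positive times; the unit ball around [1] stays among them. *)
  assert (hds : Derive s 1 = 2 * xi * a / (2 * sqrt 1)).
  { apply is_derive_unique, is_derive_ext_loc with (fun t => 2 * xi * a * sqrt t);
      [|apply is_derive_scaled_sqrt; lra].
    exists (mkposreal _ Rlt_0_1); intros t ht.
    assert (ht' : Rabs (t - 1) < 1) by exact ht.
    apply Rabs_lt_between in ht'; symmetry; apply hs; lra. }
  rewrite <- hs, <- hds, <- hstefan, hl', Rpower_1_l, <- hc1, <- hc2 by lra.
  reflexivity.
- intros x hx; rewrite <- hc1, <- hc2.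
  assert (hphi : phi x = u (2 * a * x) 1).
  { rewrite hu, sqrt_1, Rpower_1_l, Rmult_1_l; [f_equal; field; lra|lra|rewrite s1; nra]. }
  rewrite hphi; destruct (Req_dec x 0) as [->|hx0].
  + rewrite Rmult_0_r, hu0, g0; ring.
  + destruct (Req_dec x xi) as [->|hx1]; [rewrite <- s1, hus; ring|].
    apply hc; lra.
Qed.

(* The hypothesis [hedge] is void unless beta = -1 - delta.  In that case the
   right-hand side of the equation for xi is the constant 1, the left-hand side
   decreases strictly from uinf h0 / (gamma 2^beta) to 0, and a positive root
   exists exactly under [hedge]. *)
Theorem theorem2p1
  (a k gamma h0 uinf lambda beta delta alpha : R)
  (ha : 0 < a) (hk : 0 < k) (hgamma : 0 < gamma) (hh0 : 0 < h0)
  (huinf : 0 < uinf) (hlambda : 0 <= lambda)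
  (hbeta : Rmax delta (-1 - delta) <= beta)
  (hedge : beta = -1 - delta -> gamma * Rpower 2 beta < uinf * h0)
  (halpha : alpha = beta - delta) :
  exists xi : R,
    unique (fun z => 0 < z /\
      xi_equation a k gamma h0 lambda uinf beta delta alpha z) xi /\
    solves_P a k gamma h0 lambda uinf beta delta alpha
      (u_sol a k h0 lambda uinf alpha xi) (s_sol a xi) /\
    similarity_type a alpha (u_sol a k h0 lambda uinf alpha xi) (s_sol a xi) /\
    (forall (u : R -> R -> R) (s : R -> R),
       solves_P a k gamma h0 lambda uinf beta delta alpha u s ->
       similarity_type a alpha u s ->
       (forall t, 0 <= t -> s t = s_sol a xi t) /\
       (forall x t, 0 < t -> 0 <= x <= s_sol a xi t ->
          u x t = u_sol a k h0 lambda uinf alpha xi x t)).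
Proof.
(* The two bounds on [beta] give [alpha >= 0] and a nonnegative exponent [beta + delta + 1]. *)
pose proof (Rmax_l delta (-1 - delta)); pose proof (Rmax_r delta (-1 - delta)).
assert (halpha0 : 0 <= alpha) by lra.
destruct (xi_equation_unique_root a k gamma h0 uinf lambda beta delta alpha)
  as [xi hxi]; try assumption; try lra.
exists xi; split; [exact hxi|]; destruct hxi as [[hxi heq] hunique].
split; [now apply u_sol_solves|].
split; [now apply u_sol_similarity_type|].
intros u s hP [phi [xi' [hxi' [hs hu]]]].
destruct (similarity_profile_determined a k gamma h0 uinf lambda beta delta alpha xi' u s phi)
  as [heq' hphi]; try assumption.
assert (hxx : xi = xi') by now apply hunique.
subst xi'; split.
(* The similarity form covers [t > 0]; at [t = 0] the initial condition on [s] is used. *)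
- intros t [ht|<-]; [now apply hs|].
  rewrite (P_front_init _ _ _ _ _ _ _ _ _ _ _ hP); unfold s_sol; rewrite sqrt_0; ring.
- intros x t ht hx; pose proof (sqrt_lt_R0 t ht).
  rewrite hu, u_sol_ode_sol, hphi; [reflexivity| |assumption|rewrite hs; assumption].
  unfold s_sol in hx; split; [apply Rdiv_le_0_compat; nra|].
  apply Rle_div_l; nra.
Qed.
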